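(* There exists a constant $c \geq 10^{-10^{10}}$ such that the following holds: if $G$ is a path-pairable planar graph on $n$ vertices, then $\Delta(G) \geq cn$, where $\Delta(G)$ denotes the maximum degree of $G$.
   Context: All graphs are simple and undirected. A graph $G$ on $n$ vertices ($n$ even) is path-pairable if for every pairing of its vertices (i.e. every partition of $V(G)$ into $n/2$ unordered pairs $\{x_i,y_i\}$), there exist pairwise edge-disjoint paths $P_1,\dots,P_{n/2}$ in $G$ such that $P_i$ joins $x_i$ and $y_i$ for each $i$. *)

(* Defs.v *)
From HB Require Import structures.
From mathcomp Require Import all_boot all_order all_algebra.
From mathcomp Require Import classical_sets reals topology normedtype set_interval.

Set Implicit Arguments.
Unset Strict Implicit.
Unset Printing Implicit Defensive.

Import Order.TTheory GRing.Theory Num.Theory.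
Import numFieldNormedType.Exports.

Local Open Scope set_scope.

Record sgraph := SGraph {
  vertex :> finType;
  adj : rel vertex;
  adj_sym : symmetric adj;
  adj_irr : irreflexive adj }.

Section Graph.
Variable G : sgraph.

Definition edges : {set {set G}} :=
  [set [set x; y] | x in [set: G], y in [set: G] & adj x y].

Definition degree (x : G) : nat := #|[set y : G | adj x y]|.

Definition max_degree : nat := \max_(x : G) degree x.

Definition pairing (P : {set {set G}}) : bool :=
  finset.partition P [set: G] && [forall B in P, #|B| == 2].

(* A path is given by its sequence of vertices, which are pairwise distinct. *)
Definition path_joining (B : {set G}) (s : seq G) : bool :=
  if s is x :: p then
    [&& path (@adj G) x p, uniq s & B == [set x; last x p]]
  else false.

Definition path_edges (s : seq G) : {set {set G}} :=
  [set [set u.1; u.2] | u in zip s (behead s)].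

(* Parity is required: a graph of odd order has no pairing at all, so the
   second clause alone would hold vacuously. *)
Definition path_pairable : Prop :=
  ~~ odd #|[set: G]| /\
  forall P : {set {set G}}, pairing P ->
    exists w : {set G} -> seq G,
      (forall B, B \in P -> path_joining B (w B)) /\
      (forall B C, B \in P -> C \in P -> B != C ->
         [disjoint path_edges (w B) & path_edges (w C)]).

End Graph.

Section Planar.
Variable R : realType.
Local Open Scope ring_scope.
Local Open Scope classical_set_scope.

Definition is_arc (a b : R * R) (A : set (R * R)) : Prop :=
  exists g : R -> R * R,
    [/\ {within `[0, 1], continuous g},
        {in `[0, 1]%R &, injective g},
        g 0 = a, g 1 = b & A = g @` `[0, 1]].

(* The last clause, applied to (e, f) and to (f, e), confines the meeting
   points of two distinct arcs to the common ends of e and f. *)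
Definition planar (G : sgraph) : Prop :=
  exists (pos : G -> R * R) (arc : {set G} -> set (R * R)),
    [/\ injective pos,
        forall x y : G, adj x y -> is_arc (pos x) (pos y) (arc [set x; y]%SET),
        forall e : {set G}, e \in edges G ->
          arc e `&` range pos `<=` pos @` [set` e] &
        forall e f : {set G}, e \in edges G -> f \in edges G -> e != f ->
          arc e `&` arc f `<=` pos @` [set` e]].

End Planar.

(* Main.v *)
Require Import Defs.
From mathcomp Require Import all_boot all_order all_algebra.
From mathcomp Require Import boolp classical_sets reals topology normedtype set_interval.
From mathcomp Require Import derive fintype finset zify ring lra.
From Stdlib Require Import Btauto.

(* The complete graph on V(G) is covered by n pairings. Routing each of them
   along edge-disjoint paths joins every two vertices by a path in such a way
   that at most 2 n d(v) ordered pairs are routed through a vertex v. As K5 is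
   not planar, among any five vertices there are two disjoint pairs whose
   routes meet, at some vertex v; counting these meetings gives
   n^5 = O(n * sum_v (n d(v))^2). A planar graph has O(n) edges, so
   sum_v d(v)^2 = O(n Delta), and Delta is at least a constant times n.

   Nonplanarity of K5 is a parity argument. The arcs are sampled into fine
   chains of points; for disjoint edges ab and cd the numbers of crossings of
   the upward rays from a, b with the chain of cd, and from c, d with the chain
   of ab, add up to a parity that only depends on the horizontal order of a, b,
   c, d. Summing over the fifteen pairs of disjoint edges of K5 cancels all the
   crossing numbers but leaves an odd constant. The linear bound on the number
   of edges is Mader's: a graph of large average degree has a K5 minor. *)

Set Implicit Arguments.
Unset Strict Implicit.
Unset Printing Implicit Defensive.
Import Order.TTheory GRing.Theory Num.Theory.
Import numFieldNormedType.Exports.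

Local Open Scope set_scope.
Local Open Scope ring_scope.

(** * Parity of ray crossings between two fine chains of points *)

Section Crossings.
Variable R : realDomainType.
Implicit Types (d : R) (u v w : R * R) (s t : seq (R * R)).

(* Refining the sign of the abscissa lexicographically makes [lexneg] change
   under negation of any nonzero vector, so no general position is needed. *)
Definition lexneg w := (w.1 < 0) || (w.1 == 0) && (w.2 < 0).

(** A step from [w] to [w'] across the upward ray from the origin. Testing the ordinate of [w] alone
    is enough: on short steps away from the origin that change [lexneg], both ordinates have the
    same sign. *)
Definition crosses w w' := (lexneg w (+) lexneg w') && (0 < w.2).

Definition nearby d u v := (`|u.1 - v.1| < d) && (`|u.2 - v.2| < d).

(* A step of size d that changes [lexneg] ends within 2 d of the vertical axis;
   the factor 4 then fixes the sign of the ordinate around a grid square. *)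
Definition apart d u v := (d *+ 4 <= `|u.1 - v.1|) || (d *+ 4 <= `|u.2 - v.2|).

Lemma lexnegN w : w != 0 -> lexneg (- w) = ~~ lexneg w.
Proof.
case: w => x y; rewrite xpair_eqE /lexneg /= oppr_lt0 oppr_eq0 oppr_lt0.
by case: (ltgtP x 0) => //= _; case: (ltgtP y 0).
Qed.

Lemma apart_neq d u v : 0 < d -> apart d u v -> u - v != 0.
Proof.
move=> d0 /orP fuv; apply/eqP => -[e1 e2].
by case: fuv; rewrite ?e1 ?e2 normr0 leNgt pmulrn_lgt0 // d0.
Qed.

(** When [lexneg] changes, the abscissas lie weakly on opposite sides of 0, so neither exceeds their
    distance in absolute value. *)
Lemma lexneg_change d w w' : (lexneg w != lexneg w') ->
  `|w.1 - w'.1| < d *+ 2 -> `|w.1| < d *+ 2.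
Proof.
have lxle v : lexneg v -> v.1 <= 0.
  by case/orP => [/ltW//|/andP[/eqP-> _]].
have lxge v : ~~ lexneg v -> 0 <= v.1.
  by rewrite negb_or -leNgt => /andP[].
case: (boolP (lexneg w)) => [/lxle|/lxge];
  case: (boolP (lexneg w')) => [/lxle|/lxge] // a b _; 
  rewrite !ltr_norml => /andP[? ?]; apply/andP; split; lra.
Qed.

(** Both abscissas are below 4 d in absolute value, so both ordinates must reach 4 d there, and a
    change below 2 d cannot reverse the sign. *)
Lemma same_height d w w' : `|w.1| < d *+ 2 -> `|w.1 - w'.1| < d *+ 2 ->
  `|w.2 - w'.2| < d *+ 2 -> d *+ 4 <= `|w.1| \/ d *+ 4 <= `|w.2| ->
  d *+ 4 <= `|w'.1| \/ d *+ 4 <= `|w'.2| -> (0 < w.2) = (0 < w'.2).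
Proof.
rewrite !ltr_norml !ler_normr => /andP[? ?] /andP[? ?] /andP[? ?].
move=> fw fw'; have {}fw : d *+ 4 <= w.2 \/ d *+ 4 <= - w.2.
  by case: fw => /orP[]; [lra|lra|left|right].
have {}fw' : d *+ 4 <= w'.2 \/ d *+ 4 <= - w'.2.
  by case: fw' => /orP[]; [lra|lra|left|right].
by apply/idP/idP; case: fw; case: fw'; lra.
Qed.

(** If [lexneg] takes one value at the four corners, all terms vanish. Otherwise the square is close
    to the vertical axis, the ordinate keeps its sign, and the [lexneg] of each corner is counted
    twice. *)
Lemma crosses_square d a a' c c' : nearby d a a' -> nearby d c c' ->
  apart d c a -> apart d c a' -> apart d c' a -> apart d c' a' ->
  crosses (c - a) (c' - a) (+) crosses (c - a') (c' - a')
    = crosses (c - a) (c - a') (+) crosses (c' - a) (c' - a').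
Proof.
move=> /andP[a1 a2] /andP[c1 c2] /orP f00 /orP f01 /orP f10 /orP f11.
rewrite /crosses.
case: (boolP [|| lexneg (c - a) != lexneg (c' - a),
  lexneg (c - a) != lexneg (c - a') | lexneg (c - a) != lexneg (c' - a')]).
- move=> chg.
  have small : `|(c - a).1| < d *+ 2.
    case/or3P: chg => /lexneg_change; apply => /=;
    move: a1 c1; rewrite !ltr_norml => /andP[? ?] /andP[? ?];
    by apply/andP; split; lra.
  have h10 : (0 < (c - a).2) = (0 < (c' - a).2).
    apply: (same_height small) => //=;
    move: a1 c1 a2 c2; rewrite !ltr_norml => /andP[? ?] /andP[? ?] /andP[? ?] /andP[? ?];
    by apply/andP; split; lra.
  have h01 : (0 < (c - a).2) = (0 < (c - a').2).
    apply: (same_height small) => //=;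
    move: a1 c1 a2 c2; rewrite !ltr_norml => /andP[? ?] /andP[? ?] /andP[? ?] /andP[? ?];
    by apply/andP; split; lra.
  rewrite -h10 -h01.
  by do 4![case: (lexneg _)]; case: (0 < _).
- rewrite !negb_or !negbK => /and3P[/eqP<- /eqP<- /eqP<-].
  by rewrite addbb.
Qed.

Fixpoint vcrossings v p s :=
  if s is q :: s' then crosses (p - v) (q - v) (+) vcrossings v q s' else false.

(* With p - v negated, the upward ray from v becomes the downward one. *)
Fixpoint vcrossings_down v p s :=
  if s is q :: s' then crosses (v - p) (v - q) (+) vcrossings_down v q s'
  else false.

(** A step that changes [lexneg] crosses exactly one of the upward and downward rays, so the two
    counts add up to the number of changes, whose parity telescopes to the ends. *)
Lemma vcrossings_updown d v p s : 0 < d -> path (nearby d) p s ->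
  (forall q, q \in p :: s -> apart d q v) ->
  vcrossings_down v p s
    = vcrossings v p s (+) lexneg (p - v) (+) lexneg (last p s - v).
Proof.
move=> d0; elim: s p => [|q s IHs] p /=; first by rewrite addbb.
move=> /andP[/andP[c1 c2] pth] fs.
rewrite {}IHs//; last by move=> r rs; apply: fs; rewrite inE rs orbT.
suff -> : crosses (v - p) (v - q)
    = crosses (p - v) (q - v) (+) lexneg (p - v) (+) lexneg (q - v).
  case: (crosses _ _); case: (lexneg (p - v)); case: (lexneg (q - v));
  by case: (vcrossings _ _ _); case: (lexneg _).
have fp : apart d p v by apply: fs; rewrite mem_head.
have fq : apart d q v by apply: fs; rewrite !inE eqxx orbT.
rewrite /crosses -(opprB p v) -(opprB q v).
rewrite !lexnegN ?(apart_neq d0)// oppr_gt0.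
have chg : lexneg (p - v) != lexneg (q - v) -> (0 < (p - v).2) = ~~ ((p - v).2 < 0).
  move=> /lexneg_change => /(_ d) /= small; rewrite -leNgt.
  move: fp; rewrite /apart !ler_normr.
  have {small} : `|p.1 - v.1| < d *+ 2.
    apply: small; move: c1; rewrite !ltr_norml => /andP[? ?].
    by apply/andP; split; lra.
  rewrite ltr_norml => /andP[? ?] f.
  have {}f : d *+ 4 <= (p.2 - v.2) \/ d *+ 4 <= - (p.2 - v.2).
    by case/orP: f => /orP[]; [lra|lra|left|right].
  by apply/idP/idP; case: f; lra.
move: chg; case: (lexneg _); case: (lexneg _) => //= ->//; by case: (_ < 0).
Qed.

(** [crosses_square] is summed over the grid of pairs of steps: interior sides cancel and the
    boundary remains. *)
Lemma vcrossings_grid d a s c t : path (nearby d) a s -> path (nearby d) c t ->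
  (forall p q, p \in a :: s -> q \in c :: t -> apart d q p) ->
  vcrossings a c t (+) vcrossings (last a s) c t
    = vcrossings_down c a s (+) vcrossings_down (last c t) a s.
Proof.
elim: s a => [|a' s IHs] a; first by rewrite !addbb.
move=> /= /andP[caa' pths] ptht fst.
have {}IHs := IHs a' pths ptht
  (fun p q ps qt => fst p q (@mem_behead _ (a :: a' :: s) p ps) qt).
(* The row of squares that belongs to the single step from [a] to [a']. *)
suff strip : vcrossings a c t (+) vcrossings a' c t
    = crosses (c - a) (c - a') (+) crosses (last c t - a) (last c t - a').
  move: strip IHs.
  do 3![case: (vcrossings _ _ _)]; do 2![case: (vcrossings_down _ _ _)];
  by do 2![case: (crosses _ _)].
move: ptht fst; clear -caa'; elim: t c => [|c' t IHt] c; first by rewrite !addbb.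
move=> /= /andP[ccc' ptht] fst.
have {}IHt := IHt c' ptht
  (fun p q ps qt => fst p q ps (@mem_behead _ (c :: c' :: t) q qt)).
have := @crosses_square d a a' c c' caa' ccc'.
rewrite !fst ?inE ?eqxx ?orbT// => /(_ isT isT isT isT).
move: IHt; do 2![case: (vcrossings _ _ _)]; by do 6![case: (crosses _ _)].
Qed.

(** Turning downward rays into upward ones makes the roles of the two chains symmetric, at the price
    of the four [lexneg] terms at the ends. *)
Lemma crossing_relation d a s c t : 0 < d ->
  path (nearby d) a s -> path (nearby d) c t ->
  (forall p q, p \in a :: s -> q \in c :: t -> apart d q p) ->
  let b := last a s in let e := last c t in
  vcrossings a c t (+) vcrossings b c t (+) vcrossings c a s (+) vcrossings e a s
    = lexneg (a - c) (+) lexneg (b - c) (+) lexneg (a - e) (+) lexneg (b - e).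
Proof.
move=> d0 ps pt fst b e; have := vcrossings_grid ps pt fst.
have apartC p q : apart d p q = apart d q p by rewrite /apart !(distrC p.1) !(distrC p.2).
rewrite !(vcrossings_updown d0 ps).
- rewrite -/b -/e.
  do 4![case: (vcrossings _ _ _)]; by do 4![case: (lexneg _)].
- by move=> q qs; rewrite apartC; apply: fst; rewrite // mem_last.
- by move=> q qs; rewrite apartC; apply: fst; rewrite // mem_head.
Qed.
End Crossings.

(** * Nonplanarity of K5 for chains *)

Section K5.
Variable R : realDomainType.

(* Every [X v i j] occurs in two of the fifteen relations and every unordered
   pair in six of the values of [N], in an odd total number of times reversed. *)
Lemma K5_parity (X : 'I_5 -> 'I_5 -> 'I_5 -> bool) (N : 'I_5 -> 'I_5 -> bool) :
  (forall i j, i != j -> N j i = ~~ N i j) ->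
  ~ (forall i j k l : 'I_5, (i < j)%N -> (k < l)%N -> uniq [:: i; j; k; l] ->
    X i k l (+) X j k l (+) X k i j (+) X l i j
      = N i k (+) N j k (+) N i l (+) N j l).
Proof.
move=> NC E.
have add a b c d : a = b -> c = d -> a (+) c = b (+) d by move=> -> ->.
pose o m (lt_m : (m < 5)%N) : 'I_5 := Ordinal lt_m.
pose v0 := o 0 isT; pose v1 := o 1 isT; pose v2 := o 2 isT.
pose v3 := o 3 isT; pose v4 := o 4 isT.
have := add _ _ _ _ (E v0 v1 v2 v3 isT isT isT)
 (add _ _ _ _ (E v0 v2 v1 v3 isT isT isT)
 (add _ _ _ _ (E v0 v3 v1 v2 isT isT isT)
 (add _ _ _ _ (E v0 v1 v2 v4 isT isT isT)
 (add _ _ _ _ (E v0 v2 v1 v4 isT isT isT)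
 (add _ _ _ _ (E v0 v4 v1 v2 isT isT isT)
 (add _ _ _ _ (E v0 v1 v3 v4 isT isT isT)
 (add _ _ _ _ (E v0 v3 v1 v4 isT isT isT)
 (add _ _ _ _ (E v0 v4 v1 v3 isT isT isT)
 (add _ _ _ _ (E v0 v2 v3 v4 isT isT isT)
 (add _ _ _ _ (E v0 v3 v2 v4 isT isT isT)
 (add _ _ _ _ (E v0 v4 v2 v3 isT isT isT)
 (add _ _ _ _ (E v1 v2 v3 v4 isT isT isT)
 (add _ _ _ _ (E v1 v3 v2 v4 isT isT isT)
   (E v1 v4 v2 v3 isT isT isT)))))))))))))).
rewrite (NC v1 v2 isT) (NC v1 v3 isT) (NC v1 v4 isT) (NC v2 v3 isT).
rewrite (NC v2 v4 isT) (NC v3 v4 isT).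
have addbE a b : a (+) b = xorb a b by case: a; case: b.
have xorb_neq a b : xorb a b = true -> a <> b by case: a; case: b.
by rewrite !addbE; apply: xorb_neq; clear; btauto.
Qed.

(** Were all chains of disjoint pairs apart, [crossing_relation] would supply the relations that
    [K5_parity] refutes. *)
Lemma no_K5_chains (d : R) (p : 'I_5 -> R * R) (s : 'I_5 -> 'I_5 -> seq (R * R)) :
  0 < d -> injective p ->
  (forall i j : 'I_5, (i < j)%N -> path (nearby d) (p i) (s i j)) ->
  (forall i j : 'I_5, (i < j)%N -> last (p i) (s i j) = p j) ->
  exists i j k l : 'I_5, [/\ (i < j)%N, (k < l)%N, uniq [:: i; j; k; l] &
    exists a b, [/\ a \in p i :: s i j, b \in p k :: s k l & ~~ apart d b a]].
Proof.
move=> d0 p_inj s_path s_last; apply: contrapT => no_meet.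
pose X v i j := vcrossings (p v) (p i) (s i j).
pose N i j := lexneg (p i - p j).
apply: (@K5_parity X N).
  by move=> i j ij; rewrite /N -opprB lexnegN// subr_eq0 (inj_eq p_inj).
move=> i j k l ij kl ijkl; rewrite /X /N.
have /= := @crossing_relation _ d (p i) (s i j) (p k) (s k l) d0 (s_path i j ij)
  (s_path k l kl); rewrite !s_last//; apply.
move=> a b aij bkl; apply: contrapT => nfar; apply: no_meet.
by exists i, j, k, l; split=> //; exists a, b; split=> //; apply/negP.
Qed.
End K5.

(** * Sampling and separation of compact connected sets *)

Section Arcs.
Variable R : realType.
Local Open Scope classical_set_scope.
Implicit Types (A B : set (R * R)) (d : R) (u v : R * R).

Lemma ball_nearby d u v : ball u d v <-> nearby d u v.
Proof. by split => [[? ?]|/andP[? ?]]; [apply/andP|]; split. Qed.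

Lemma nearbyC d u v : nearby d u v = nearby d v u.
Proof. by rewrite /nearby !(distrC v.1) !(distrC v.2). Qed.

(** The points that chains inside [A] reach from [u] form a nonempty set, open and closed relative
    to [A]. *)
Lemma connected_chain A d u v : 0 < d -> connected A -> A u -> A v ->
  exists s, [/\ path (nearby d) u s, last u s = v & forall q, q \in u :: s -> A q].
Proof.
move=> d0 cA Au.
pose chained := [set w | exists s, [/\ path (nearby d) u s, last u s = w &
  forall q, q \in u :: s -> A q]].
have chA w : chained w -> A w.
  by case=> s [_ <- sA]; apply: sA; apply: mem_last.
have step w w' : chained w -> A w' -> nearby d w w' -> chained w'.
  case=> s [pths lst sA] Aw' ww'; exists (rcons s w').
  rewrite rcons_path last_rcons pths lst; split=> // q.
  by rewrite -rcons_cons mem_rcons inE => /orP[/eqP->//|/sA].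
suff chE : chained = A by rewrite -{1}chE.
apply: cA.
- by exists u, [::]; split=> // q; rewrite inE => /eqP->.
(* The interior of the union of balls is open and still contains every centre. *)
- exists (\bigcup_(w in chained) ball w d)^°; first exact: open_interior.
  apply/seteqP; split=> [w chw|w [Aw /interior_subset[w' chw' /ball_nearby]]].
    split; first exact: chA.
    have : nbhs w (ball w d) by apply: nbhsx_ballx.
    by apply: filterS => w' ww'; exists w.
  by move/(step w' w chw' Aw).
(* Closedness is openness of the unreachable part: the ball around an unreachable point contains no
   reachable one. *)
- exists (~` (\bigcup_(w in A `\` chained) ball w d)^°).
    by apply: open_closedC; exact: open_interior.
  apply/seteqP; split=> [w chw|w [Aw nw]].
    split; first exact: chA.
    move=> /interior_subset[w' [Aw' nchw'] /ball_nearby]; rewrite nearbyC.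
    by move/(step w w' chw Aw').
  apply: contrapT => nchw; apply: nw.
  have : nbhs w (ball w d) by apply: nbhsx_ballx.
  by apply: filterS => w' ww'; exists w.
Qed.

(** The sum of the two coordinate gaps is continuous on the compact product and attains its minimum,
    which is positive because the sets are disjoint. *)
Lemma compact_apart A B : compact A -> compact B -> A `&` B = classical_sets.set0 ->
  exists2 d : R, 0 < d & forall a b, A a -> B b -> apart d b a.
Proof.
move=> cA cB AB.
have [->|/classical_sets.set0P[a0 Aa0]] := eqVneq A classical_sets.set0; first by exists 1.
have [->|/classical_sets.set0P[b0 Bb0]] := eqVneq B classical_sets.set0; first by exists 1.
pose f (x : (R * R) * (R * R)) : R :=
  `|x.2.1 - x.1.1| + `|x.2.2 - x.1.2|.
have cf : {within A `*` B, continuous f}.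
  apply: continuous_subspaceT => x; apply: cvgD; apply: cvg_norm; apply: cvgB.
  - by apply: (@cvg_comp _ _ _ snd fst); [exact: cvg_snd|exact: cvg_fst].
  - by apply: (@cvg_comp _ _ _ fst fst); [exact: cvg_fst|exact: cvg_fst].
  - by apply: (@cvg_comp _ _ _ snd snd); [exact: cvg_snd|exact: cvg_snd].
  - by apply: (@cvg_comp _ _ _ fst snd); [exact: cvg_fst|exact: cvg_snd].
have [] := compact_EVT_min _ (compact_setX cA cB) cf; first by exists (a0, b0).
move=> [a b] /set_mem[/= Aa Bb] fmin.
have fab : 0 < f (a, b).
  rewrite lt_neqAle addr_ge0// andbT eq_sym paddr_eq0// !normr_eq0 !subr_eq0.
  apply/negP => /andP[/eqP ba1 /eqP ba2].
  suff : (A `&` B) a by rewrite AB.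
  by split=> //; rewrite (surjective_pairing a) -ba1 -ba2 -surjective_pairing.
(* With minimum m, two gaps below 4 (m / 8) = m / 2 would sum to less than m. *)
exists (f (a, b) / 8); first by rewrite divr_gt0.
move=> a' b' Aa' Bb'.
have /fmin : (a', b') \in A `*` B by exact: mem_set.
move: fab; rewrite {3}/f /apart /=; move: (f (a, b)) => m m0 mle.
by have [?|?] := leP (m / 8 *+ 4) `|b'.1 - a'.1| => //=; lra.
Qed.

Lemma arc_compact_connected u v A : is_arc u v A ->
  [/\ compact A, connected A, A u & A v].
Proof.
case=> g [cg _ <- <- ->]; split.
- by apply: continuous_compact => //; exact: segment_compact.
- by apply: connected_continuous_connected => //; exact: segment_connected.
- by exists 0 => //=; rewrite in_itv /= lexx ler01.
- by exists 1 => //=; rewrite in_itv /= lexx ler01.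
Qed.

End Arcs.

Lemma apartW (R : realDomainType) (d d' : R) u v :
  d' <= d -> apart d u v -> apart d' u v.
Proof.
move=> d'd; have d4 : d' *+ 4 <= d *+ 4 by rewrite lerMn2r d'd orbT.
by case/orP=> /(le_trans d4) le4; apply/orP; [left|right].
Qed.

(** * From plane drawings to walks that meet *)

Section Drawing.
Variables (R : realType) (G : sgraph) (pos : G -> R * R).
Variable arc : {set G} -> set (R * R).
Hypothesis adj_arc :
  forall x y : G, adj x y -> is_arc (pos x) (pos y) (arc [set x; y]%SET).

Lemma edgesP (e : {set G}) :
  reflect (exists x y, adj x y /\ e = [set x; y]%SET) (e \in edges G).
Proof.
apply: (iffP imset2P) => [[x y _]|[x [y [xy ->]]]].
  by rewrite inE => /andP[_ xy] ->; exists x, y.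
by exists x y; rewrite ?inE.
Qed.

Lemma edge_arc (e : {set G}) : e \in edges G ->
  [/\ compact (arc e), connected (arc e) & forall x, x \in e -> arc e (pos x)].
Proof.
case/edgesP => x [y [/adj_arc/arc_compact_connected[cA kA Ax Ay] ->]].
by split=> // z; rewrite !inE => /orP[]/eqP->.
Qed.

(** Each sampled point is charged to an edge within the walk, which lets disjoint walks be treated
    through disjoint edges. A walk of length 0 would have no edge to charge. *)
Lemma walk_chain (d : R) (x : G) (p : seq G) : 0 < d -> path (@adj G) x p ->
  p != [::] -> exists s : seq (R * R),
  [/\ path (nearby d) (pos x) s, last (pos x) s = pos (last x p) &
    forall q, q \in pos x :: s -> exists e : {set G},
      [/\ e \in edges G, {subset e <= x :: p} & arc e q]].
Proof.
move=> d0; elim: p x => // y p IHp x /= /andP[xy yp] _.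
have eG : [set x; y]%SET \in edges G by apply/edgesP; exists x, y.
have [_ cA Apos] := edge_arc eG.
have [||s1 [ps1 ls1 As1]] := connected_chain d0 cA (Apos x _) (Apos y _).
- by rewrite !inE eqxx.
- by rewrite !inE eqxx orbT.
have sxy : {subset [set x; y]%SET <= [:: x, y & p]}.
  by move=> z; rewrite !inE orbA => ->.
have [p0|p0] := eqVneq p [::].
  rewrite p0 /=; exists s1; split=> // q /As1 qA.
  by exists [set x; y]%SET; split=> //; rewrite -p0.
have [s2 [ps2 ls2 As2]] := IHp y yp p0.
exists (s1 ++ s2); rewrite cat_path last_cat ls1 ps1 ps2 ls2; split=> // q.
rewrite -cat_cons mem_cat => /orP[/As1 qA|qs2].
  by exists [set x; y]%SET.
have /As2[e [eE sub eq]] : q \in pos y :: s2 by rewrite inE qs2 orbT.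
by exists e; split=> // z /sub zp; rewrite in_cons zp orbT.
Qed.

Hypothesis arc_disjoint : forall e f : {set G}, e \in edges G -> f \in edges G ->
  e != f -> (arc e `&` arc f `<=` pos @` [set` e])%classic.
Hypothesis pos_inj : injective pos.

(** A common point is the position of an end of [e] and, by symmetry, of an end of [f]; injectivity
    of [pos] identifies the two vertices. *)
Lemma disjoint_arcs (e f : {set G}) : e \in edges G -> f \in edges G ->
  [disjoint e & f] -> (arc e `&` arc f = classical_sets.set0)%classic.
Proof.
move=> eG fG; rewrite -setI_eq0 => /eqP ef0.
have ef : e != f.
  apply/eqP => ef; move: ef0; rewrite ef setIid => f0.
  case/edgesP: fG => x [y [_ fE]].
  by move/setP/(_ x): f0; rewrite fE !inE eqxx.
apply/seteqP; split=> // q [eq fq].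
have [x /= xe xq] := arc_disjoint eG fG ef (conj eq fq).
have [|y /= yf yq] := arc_disjoint fG eG _ (conj fq eq).
  by rewrite eq_sym.
have xy : x = y by apply: pos_inj; rewrite xq yq.
by move/setP/(_ x): ef0; rewrite !inE xe {1}xy yf.
Qed.

(** There are finitely many pairs of edges, so the least of their distances serves them all; pairs
    outside the condition get the value 1. *)
Lemma arcs_apart : exists2 d : R, 0 < d & forall e f : {set G},
  e \in edges G -> f \in edges G -> [disjoint e & f] ->
  forall a b, arc e a -> arc f b -> apart d b a.
Proof.
have /choice[D D_P] (ef : {set G} * {set G}) : exists d : R, 0 < d /\
    (ef.1 \in edges G -> ef.2 \in edges G -> [disjoint ef.1 & ef.2] ->
     forall a b, arc ef.1 a -> arc ef.2 b -> apart d b a).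
  case: (pselect [/\ ef.1 \in edges G, ef.2 \in edges G & [disjoint ef.1 & ef.2]]).
    case=> eG fG dis; have [ce _ _] := edge_arc eG; have [cf _ _] := edge_arc fG.
    by have [d d0 dP] := compact_apart ce cf (disjoint_arcs eG fG dis); exists d.
  by move=> nef; exists 1; split=> // eG fG dis; case: nef.
exists (\big[Order.min/1]_(ef : {set G} * {set G}) D ef).
  by apply/lt_bigmin => // ef _; have [] := D_P ef.
move=> e f eG fG dis a b ea fb; apply: (@apartW _ (D (e, f))).
  exact: bigmin_le_cond.
by have [_ /(_ eG fG dis _ _ ea fb)] := D_P (e, f).
Qed.

End Drawing.

(** The walks are sampled at the scale [d] of [arcs_apart]. Two chains that come close do so on arcs
    of edges [e] and [f], which must then share a vertex, and this vertex is on both walks. *)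
Lemma planar_walks_meet (R : realType) (G : sgraph) (v : 'I_5 -> G)
    (W : 'I_5 -> 'I_5 -> seq G) : planar R G -> injective v ->
  (forall i j : 'I_5, (i < j)%N -> path (@adj G) (v i) (W i j)) ->
  (forall i j : 'I_5, (i < j)%N -> last (v i) (W i j) = v j) ->
  exists i j k l : 'I_5, [/\ (i < j)%N, (k < l)%N, uniq [:: i; j; k; l] &
    exists2 x, x \in v i :: W i j & x \in v k :: W k l].
Proof.
case=> pos [arc [pos_inj adj_arc _ arc_disjoint]] v_inj Wpath Wlast.
have [d d0 d_apart] := arcs_apart adj_arc arc_disjoint pos_inj.
have /choice[S S_P] (ij : 'I_5 * 'I_5) : exists s : seq (R * R), (ij.1 < ij.2)%N ->
  [/\ path (nearby d) (pos (v ij.1)) s, last (pos (v ij.1)) s = pos (v ij.2) &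
    forall q, q \in pos (v ij.1) :: s -> exists e : {set G},
      [/\ e \in edges G, {subset e <= v ij.1 :: W ij.1 ij.2} & arc e q]].
  have [ij_lt|_] := boolP (ij.1 < ij.2)%N; last by exists [::].
  rewrite -(Wlast _ _ ij_lt).
  have [|s] := walk_chain adj_arc d0 (Wpath _ _ ij_lt); last by exists s.
  apply/eqP => W0; have := Wlast _ _ ij_lt; rewrite W0 /= => /v_inj ijE.
  by rewrite ijE ltnn in ij_lt.
have [|||i [j [k [l [ij kl ijkl [a [b [aij bkl nab]]]]]]]] :=
  @no_K5_chains R d (pos \o v) (fun i j => S (i, j)) d0.
- exact: inj_comp.
- by move=> i j ij; have [] := S_P (i, j) ij.
- by move=> i j ij; have [] := S_P (i, j) ij.
exists i, j, k, l; split=> //.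
have [_ _ /(_ _ aij)[e [eG sube ea]]] := S_P (i, j) ij.
have [_ _ /(_ _ bkl)[f [fG subf fb]]] := S_P (k, l) kl.
have : ~~ [disjoint e & f].
  by apply: contra nab => dis; apply: d_apart dis _ _ ea fb.
by case/pred0Pn => x /andP[/= /sube xe /subf xf]; exists x.
Qed.

Local Open Scope nat_scope.

(** * Clique minors and the linear bound on the number of edges *)

Section Minors.
Variable G : sgraph.
Implicit Types (A B C D X Y : {set G}) (F K : {set {set G}}).

Definition link A B := (A != B) && [exists x in A, exists y in B, adj x y].

Definition inner_adj A := [rel x y : G | [&& x \in A, y \in A & adj x y]].

Definition connected_in A := {in A &, forall x y, connect (inner_adj A) x y}.

Definition branch_family F :=
  trivIset F /\ forall A, A \in F -> A != set0 /\ connected_in A.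

(** Links are counted in both orders: this is the degree sum of the quotient graph on [F]. *)
Definition link_count F := \sum_(A in F) \sum_(B in F) link A B.

Definition contract F A B := (A :|: B) |: (F :\ A :\ B).

Lemma linkP A B : reflect (A != B /\ exists x y, [/\ x \in A, y \in B & adj x y])
  (link A B).
Proof.
apply: (iffP andP) => -[AB].
  by case/existsP => x /andP[xA /existsP[y /andP[yB xy]]]; split=> //; exists x, y.
case=> x [y [xA yB xy]]; split=> //; apply/existsP; exists x; rewrite xA.
by apply/existsP; exists y; rewrite yB.
Qed.

Lemma linkC A B : link A B = link B A.
Proof.
suff sub A' B' : link A' B' -> link B' A' by apply/idP/idP; exact: sub.
case/linkP => AB [x [y [xA yB xy]]]; apply/linkP; rewrite eq_sym; split=> //.
by exists y, x; rewrite (@adj_sym G).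
Qed.

Lemma linkxx A : link A A = false.
Proof. by rewrite /link eqxx. Qed.

Lemma linkU A B D : D != A -> D != B -> D != A :|: B ->
  link (A :|: B) D = link A D || link B D.
Proof.
move=> DA DB DAB; apply/linkP/orP.
  case=> _ [x [y [/setUP[xA|xB] yD xy]]]; [left|right]; apply/linkP;
  by rewrite eq_sym; split=> //; exists x, y.
by case=> /linkP[_ [x [y [xX yD xy]]]]; rewrite eq_sym; split=> //;
  exists x, y; split=> //; rewrite inE xX ?orbT.
Qed.

Lemma link_countU1 F X : X \notin F ->
  link_count (X |: F) = link_count F + 2 * \sum_(D in F) link X D.
Proof.
move=> XF; rewrite /link_count big_setU1//= big_setU1//= linkxx add0n.
have -> : \sum_(A in F) \sum_(B in X |: F) link A B =
    \sum_(A in F) (link X A + \sum_(B in F) link A B).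
  by apply: eq_bigr => A _; rewrite big_setU1//= linkC.
by rewrite big_split /= addnC mul2n -addnn addnA [in RHS]addnC !addnA.
Qed.

Lemma connected_inU A B : connected_in A -> connected_in B -> link A B ->
  connected_in (A :|: B).
Proof.
move=> cA cB /linkP[_ [a [b [aA bB ab]]]].
have sub X x y : X \subset A :|: B -> connect (inner_adj X) x y ->
    connect (inner_adj (A :|: B)) x y.
  move=> /subsetP XU; apply: connect_sub => u v /and3P[/XU uX /XU vX uv].
  by apply: connect1; rewrite /= uX vX.
have ba : connect (inner_adj (A :|: B)) b a.
  by apply: connect1; rewrite /= !inE aA bB orbT (@adj_sym G).
have {ab}ab : connect (inner_adj (A :|: B)) a b.
  by apply: connect1; rewrite /= !inE aA bB orbT.
move=> x y /setUP[xA|xB] /setUP[yA|yB].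
- exact: sub (subsetUl A B) (cA _ _ xA yA).
- apply: connect_trans (sub _ _ _ (subsetUl A B) (cA _ _ xA aA)) _.
  by apply: connect_trans ab (sub _ _ _ (subsetUr A B) (cB _ _ bB yB)).
- apply: connect_trans (sub _ _ _ (subsetUr A B) (cB _ _ xB bB)) _.
  by apply: connect_trans ba (sub _ _ _ (subsetUl A B) (cA _ _ aA yA)).
- exact: sub (subsetUr A B) (cB _ _ xB yB).
Qed.

Section Contraction.
Variables (F : {set {set G}}) (A B : {set G}).
Hypotheses (famF : branch_family F) (AF : A \in F) (BF : B \in F).
Hypothesis linkAB : link A B.

Let AB : A != B. Proof. by case/andP: linkAB. Qed.

Let U_disjoint C : C \in F :\ A :\ B -> [disjoint A :|: B & C].
Proof.
rewrite !inE => /and3P[CB CA CF]; have [/trivIsetP tF _] := famF.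
by rewrite -setI_eq0 setIUl setU_eq0 !setI_eq0 !tF// eq_sym.
Qed.

Let U_notin : A :|: B \notin F :\ A :\ B.
Proof.
apply/negP => /U_disjoint; rewrite -setI_eq0 setIid setU_eq0 => /andP[/eqP A0 _].
by have [_ /(_ _ AF)[]] := famF; rewrite A0 eqxx.
Qed.

Lemma branch_family_contract : branch_family (contract F A B).
Proof.
have [tF cF] := famF; split.
  apply/trivIsetP => C D /setU1P[->|CF] /setU1P[->|DF].
  - by rewrite eqxx.
  - by move=> _; apply: U_disjoint.
  - by move=> _; rewrite disjoint_sym; apply: U_disjoint.
  - move: CF DF; rewrite !inE => /and3P[_ _ CF] /and3P[_ _ DF].
    exact: (trivIsetP tF).
move=> C /setU1P[->|]; last by rewrite !inE => /and3P[_ _ /cF].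
have [A0 cA] := cF A AF; have [_ cB] := cF B BF.
by rewrite setU_eq0 negb_and A0; split=> //; apply: connected_inU.
Qed.

Lemma card_contract : #|contract F A B|.+1 = #|F|.
Proof.
rewrite cardsU1 U_notin (cardsD1 A F) AF (cardsD1 B (F :\ A)).
by rewrite !inE BF eq_sym AB.
Qed.

(** Contraction loses the link between [A] and [B] and merges the two links to each common
    neighbour; counting both orders doubles the loss. *)
Lemma link_count_contract :
  link_count F = link_count (contract F A B) + 2 * (\sum_(D in F) (link A D && link B D)).+1.
Proof.
have BFA : B \in F :\ A by rewrite !inE eq_sym AB.
have -> : \sum_(D in F) (link A D && link B D)
    = \sum_(D in F :\ A :\ B) (link A D && link B D).
  rewrite (big_setD1 A)//= linkxx add0n (big_setD1 B)//= linkxx andbF.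
  by rewrite add0n.
have FE : F = A |: (B |: (F :\ A :\ B)) by rewrite !setD1K.
rewrite {1}FE !link_countU1 ?U_notin//; first last.
- by rewrite (setD1K BFA) !inE eqxx.
- by rewrite !inE eqxx.
rewrite big_setU1 ?inE ?eqxx//= linkAB.
have : \sum_(D in F :\ A :\ B) link A D + \sum_(D in F :\ A :\ B) link B D
  = \sum_(D in F :\ A :\ B) link (A :|: B) D
  + \sum_(D in F :\ A :\ B) (link A D && link B D).
  rewrite -!big_split; apply: eq_bigr => D DF; rewrite linkU.
  - by case: link; case: link.
  - by move: DF; rewrite !inE => /and3P[].
  - by move: DF; rewrite !inE => /and3P[].
  - by apply: contraNneq U_notin => <-.
move: (\sum_(D in _) link A D) (\sum_(D in _) link B D).
move: (\sum_(D in _) link (A :|: B) D) (\sum_(D in _) (_ && _)) (link_count _).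
move=> u i c a b /=; lia.
Qed.

Lemma cover_contract : cover (contract F A B) = cover F.
Proof.
have BFA : B \in F :\ A by rewrite !inE eq_sym AB.
have FE : F = A |: (B |: (F :\ A :\ B)) by rewrite !setD1K.
rewrite [in RHS]FE /cover /contract big_setU1 ?U_notin//=.
rewrite big_setU1 /=; last by rewrite (setD1K BFA) !inE eqxx.
by rewrite big_setU1 /= ?setUA// !inE eqxx.
Qed.

End Contraction.

(** The last clause serves the induction inside the neighbourhood of a member [A]: a branch set that
    contains a neighbour is linked to [A], and one covered by neighbours is disjoint from [A]. *)
Definition clique_minor (n : nat) F K := [/\ branch_family K, #|K| = n,
  {in K &, forall X Y, X != Y -> link X Y} &
  forall X, X \in K -> X \subset cover F /\ exists2 B, B \in F & B \subset X].

(* Mader's argument: once every link lies in many triangles, the neighbourhood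
   of a member is dense enough to contain a smaller clique minor. *)
Lemma clique_minor_of_dense r F : branch_family F -> F != set0 ->
  2 ^ r * #|F| <= link_count F -> exists K, clique_minor r.+1 F K.
Proof.
elim: r F => [|r IHr] F famF F0 dense.
  have [A AF] := set0Pn _ F0; exists [set A]; split.
  - split; first exact: trivIset1.
    by have [_ cF] := famF => B /set1P->; apply: cF.
  - exact: cards1.
  - by move=> X Y /set1P-> /set1P->; rewrite eqxx.
  - move=> X /set1P->; split; last by exists A.
    by rewrite /cover (bigcup_sup A).
have [m] := ubnP #|F|; elim: m F famF F0 dense => // m IHm F famF F0 dense.
move=> Fm; have [tF cF] := famF.
(* A link in fewer than 2 ^ r triangles can be contracted: the count drops by at most 2 ^ r.+1 and
   the family by one member, so the density persists. *)
case: (boolP [exists A in F, exists B in F, link A B &&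
  (\sum_(D in F) (link A D && link B D) < 2 ^ r)]).
  case/existsP => A /andP[AF /existsP[B /and3P[BF lAB few]]].
  have cardF := card_contract famF AF BF lAB.
  have [||||K [famK cardK cliqueK subK]] := IHm (contract F A B).
  - exact: branch_family_contract.
  - by apply/set0Pn; exists (A :|: B); rewrite setU11.
  - move: few dense; rewrite (link_count_contract famF AF BF lAB) -cardF.
    rewrite expnS -!mulnA mulnS.
    by move: (\sum_(D in _) _) (link_count _) (2 ^ r * _) => s c e; lia.
  - by rewrite cardF.
  exists K; split=> // X /subK[]; rewrite cover_contract// => XF [C CK CX].
  split=> //; case/setU1P: CK => [CU|]; last first.
    by rewrite !inE => /and3P[_ _ CF]; exists C.
  by exists A => //; apply: subset_trans CX; rewrite CU subsetUl.
rewrite negb_exists => /forallP many.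
have {}many A B : A \in F -> B \in F -> link A B ->
    2 ^ r <= \sum_(D in F) (link A D && link B D).
  move=> AF BF lAB; have := many A; rewrite AF negb_exists => /forallP/(_ B).
  by rewrite BF lAB /= -leqNgt.
have [A [B [AF BF lAB]]] : exists A B, [/\ A \in F, B \in F & link A B].
  have : 0 < link_count F.
    by apply: leq_trans dense; rewrite muln_gt0 expn_gt0 card_gt0.
  rewrite lt0n sum_nat_eq0 negb_forall => /existsP[A].
  rewrite negb_imply sum_nat_eq0 negb_forall => /andP[AF /existsP[B]].
  by rewrite negb_imply => /andP[BF]; case lAB: (link A B) => // _; exists A, B.
pose N := [set B in F | link A B].
have NF : N \subset F by apply/subsetP => C; rewrite inE => /andP[].
have famN : branch_family N.
  by split; [exact: trivIsetS NF tF|move=> C /(subsetP NF)/cF].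
have N0 : N != set0 by apply/set0Pn; exists B; rewrite inE BF.
(* A member [C] of [N] is linked, inside [N], to all common neighbours of [A] and [C], and there are
   at least 2 ^ r of them. *)
have denseN : 2 ^ r * #|N| <= link_count N.
  rewrite mulnC -sum_nat_const; apply: leq_sum => C; rewrite inE => /andP[CF AC].
  apply: leq_trans (many A C AF CF AC) _.
  rewrite [leqRHS]big_mkcond [leqLHS]big_mkcond; apply: leq_sum => D _.
  by rewrite inE; case: (D \in F); case: (link A D).
have [K [famK cardK cliqueK subK]] := IHr N famN N0 denseN.
have A_disjoint X : X \in K -> [disjoint A & X].
  move=> /subK[XN _]; rewrite disjoint_sym; apply: disjointWl XN _.
  rewrite disjoint_sym; apply/bigcup_disjointP => C; rewrite inE => /andP[CF /andP[AC _]].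
  by rewrite disjoint_sym; apply: (trivIsetP tF); rewrite // eq_sym.
have [A0 cA] := cF A AF.
have AX X : X \in K -> A != X.
  move=> /A_disjoint AX; apply: contraNneq A0 => eAX.
  by move: AX; rewrite -eAX -setI_eq0 setIid.
have linkAX X : X \in K -> link A X.
  move=> XK; apply/linkP; split; first exact: AX.
  have [_ [C + CX]] := subK X XK; rewrite inE => /andP[_ /linkP[_ [x [y [xA yC xy]]]]].
  by exists x, y; rewrite (subsetP CX).
exists (A |: K); split.
- have [tK cK] := famK; split.
    apply/trivIsetP => X Y /setU1P[->|XK] /setU1P[->|YK].
    + by rewrite eqxx.
    + by move=> _; apply: A_disjoint.
    + by move=> _; rewrite disjoint_sym; apply: A_disjoint.
    + exact: (trivIsetP tK).
  by move=> X /setU1P[->//|/cK].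
- rewrite cardsU1 cardK; case: (boolP (A \in K)) => // /AX; by rewrite eqxx.
- move=> X Y /setU1P[->|XK] /setU1P[->|YK].
  + by rewrite eqxx.
  + by move=> _; apply: linkAX.
  + by move=> _; rewrite linkC; apply: linkAX.
  + exact: cliqueK.
- move=> X /setU1P[->|/subK[XN [C CN CX]]]; split.
  + by rewrite /cover (bigcup_sup A).
  + by exists A.
  + apply: subset_trans XN _; apply/bigcupsP => D /(subsetP NF) DF.
    by rewrite /cover (bigcup_sup D).
  + by exists C => //; apply: (subsetP NF).
Qed.

Lemma link_count_singletons :
  link_count [set [set x] | x in [set: G]] = \sum_(x : G) degree x.
Proof.
have inj1 : {in [set: G] &, injective (@set1 G)} by move=> x y _ _ /set1_inj.
rewrite /link_count big_imset//=.
under eq_bigr do rewrite big_imset//=.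
apply: eq_big => [x|x _]; first by rewrite inE.
rewrite /degree -sum1_card [RHS]big_mkcond /=.
apply: eq_big => [y|y _]; first by rewrite inE.
rewrite inE /link; have -> : [exists x' in [set x], exists y' in [set y], adj x' y'] = adj x y.
  apply/existsP/idP => [[x' /andP[/set1P-> /existsP[y' /andP[/set1P->]]]]//|xy].
  by exists x; rewrite set11; apply/existsP; exists y; rewrite set11.
have [/set1_inj->|_] := eqVneq [set x] [set y]; first by rewrite (@adj_irr G).
by case: (adj x y).
Qed.

End Minors.

(** Otherwise the singletons are dense enough for a K5 minor. With a vertex [v i] in each branch set
    [B i] and walks from [v i] to [v j] inside [B i :|: B j], walks of disjoint pairs cannot meet,
    against [planar_walks_meet]. *)
Lemma planar_degree_sum (R : realType) (G : sgraph) : planar R G -> 0 < #|G| ->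
  \sum_(x : G) degree x < 2 ^ 4 * #|G|.
Proof.
move=> plG; rewrite -cardsT card_gt0 => /set0Pn[x0 _].
rewrite ltnNge; apply/negP => dense.
pose F := [set [set x] | x in [set: G]].
have cardF : #|F| = #|[set: G]| by apply: card_imset; exact: set1_inj.
have famF : branch_family F.
  split.
    apply/trivIsetP => _ _ /imsetP[x _ ->] /imsetP[y _ ->] xy.
    by rewrite disjoints1 inE; apply: contraNneq xy => ->.
  move=> A /imsetP[x _ ->]; split; first by apply/set0Pn; exists x; rewrite set11.
  by move=> y z /set1P-> /set1P->.
have [||K [[tK cK] cardK linkK _]] := @clique_minor_of_dense G 4 F famF.
- by apply/set0Pn; exists [set x0]; apply: imset_f.
- by rewrite cardF link_count_singletons.
pose B (i : 'I_5) := enum_val (cast_ord (esym cardK) i).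
have BK i : B i \in K by apply: enum_valP.
have B_disj i j : i != j -> [disjoint B i & B j].
  move=> ij; apply: (trivIsetP tK) => //; apply: contraNneq ij.
  by move/enum_val_inj/cast_ord_inj->.
have /fin_all_exists[v vB] i : exists x, x \in B i.
  by apply/set0Pn; have [] := cK _ (BK i).
have v_inj : injective v.
  move=> i j vij; apply/eqP; apply: contraT => /B_disj; rewrite -setI_eq0.
  by move/eqP/setP/(_ (v i)); rewrite !inE vB vij vB.
have /fin_all_exists[W W_P] (ij : 'I_5 * 'I_5) : exists p, ij.1 != ij.2 ->
    [/\ path (@adj G) (v ij.1) p, last (v ij.1) p = v ij.2 &
        {subset v ij.1 :: p <= B ij.1 :|: B ij.2}].
  case: ij => i j /=.
  have [->|ij] := eqVneq i j; first by exists [::].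
  have Bij : B i != B j.
    apply: contraTneq (B_disj _ _ ij) => ->; rewrite -setI_eq0 setIid.
    by have [] := cK _ (BK j).
  have BU := connected_inU (cK _ (BK i)).2 (cK _ (BK j)).2 (linkK _ _ (BK i) (BK j) Bij).
  have /fingraph.connectP[p pth lst] :
      connect (inner_adj (B i :|: B j)) (v i) (v j).
    by apply: BU; rewrite inE vB ?orbT.
  exists p => _; split=> //.
    by apply: sub_path pth => x y /and3P[].
  move=> x; rewrite inE => /orP[/eqP->|]; first by rewrite inE vB.
  elim: p (v i) pth {lst} => //= y p IHp z /andP[/and3P[_ yU _] pth].
  by rewrite inE => /orP[/eqP->//|]; apply: IHp pth.
have [||i [j [k [l [ij kl ijkl [x]]]]]] :=
  @planar_walks_meet R G v (fun i j => W (i, j)) plG v_inj.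
- by move=> i j; rewrite ltn_neqAle => /andP[ij _]; have [] := W_P (i, j) ij.
- by move=> i j; rewrite ltn_neqAle => /andP[ij _]; have [] := W_P (i, j) ij.
have neq (a b : 'I_5) : a < b -> a != b by rewrite ltn_neqAle => /andP[].
have [_ _ sub1] := W_P (i, j) (neq _ _ ij).
have [_ _ sub2] := W_P (k, l) (neq _ _ kl).
move=> /sub1 x1 /sub2 x2; move: ijkl; rewrite /= !inE !negb_or.
case/and3P => /and3P[_ ik il] /andP[jk jl] _.
have: [disjoint B i :|: B j & B k :|: B l].
  rewrite -setI_eq0 setIUl !setIUr !setU_eq0 !setI_eq0.
  by rewrite !B_disj.
by move/pred0P/(_ x); rewrite /= x1 x2.
Qed.

(** * Routing all pairs of vertices through few paths per vertex *)

Section Routing.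
Variable G : sgraph.

(** The k-th pairing matches distinct x and y of sum k modulo n, so any two elements are partners
    for k = x + y. Leftover elements differ by [h], which is n / 2. *)
Lemma round_robin n : 0 < n -> ~~ odd n ->
  exists tau : 'I_n -> 'I_n -> 'I_n, [/\ forall k, involutive (tau k),
    forall k x, tau k x != x & forall x y, x != y -> exists k, tau k x = y].
Proof.
case: n => // n _ even_n; pose h : 'I_n.+1 := inZp n.+1./2.
have hh : (h + h = 0)%R.
  apply: val_inj; rewrite /= modnDm addnn -[uphalf n]/(n.+1./2).
  by rewrite even_halfK// modnn.
have h0 : h != 0%R.
  by case: n @h hh even_n => // n h _ _; rewrite -val_eqE /= modn_small; lia.
(* x |-> k - x, with its two fixed points, if any, exchanged. *)
exists (fun k x => if k - x == x then x + h else k - x)%R; split.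
- move=> k x /=; have [kx|kx] := eqVneq (k - x)%R x.
    have -> : (k - (x + h) == x + h)%R.
      by rewrite opprD addrA kx (inj_eq (addrI x)) eq_sym -addr_eq0 hh.
    by rewrite -addrA hh addr0.
  by rewrite subKr eq_sym (negPf kx).
- move=> k x; have [_|//] := eqVneq (k - x)%R x.
  by rewrite -subr_eq0 addrAC subrr add0r.
- move=> x y xy; exists (x + y)%R; rewrite addrAC subrr add0r eq_sym.
  by rewrite (negPf xy).
Qed.

Lemma pairing_involution (tau : G -> G) : involutive tau ->
  (forall x, tau x != x) -> pairing [set [set x; tau x] | x in [set: G]].
Proof.
move=> tauK tau_neq; apply/andP; split; last first.
  apply/forallP => B; apply/implyP => /imsetP[x _ ->].
  by rewrite cards2 (eq_sym x) tau_neq.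
apply/and3P; split.
- rewrite eqEsubset subsetT /=. apply/subsetP => x _.
  by apply/bigcupP; exists [set x; tau x]; [exact: imset_f|exact: set21].
- apply/trivIsetP => _ _ /imsetP[x _ ->] /imsetP[y _ ->].
  apply: contraR; rewrite -setI_eq0 => /set0Pn[z]; rewrite !inE.
  case/andP => /orP[]/eqP-> /orP[/eqP e|/eqP e]; apply/eqP.
  + by rewrite e.
  + by rewrite e tauK setUC.
  + by rewrite -e tauK setUC.
  + by rewrite (can_inj tauK e).
- apply/imsetP => -[x _ /setP/(_ x)]; by rewrite !inE eqxx.
Qed.

(** A path through [v] uses an edge at [v], since its ends are distinct. Edge-disjointness makes the
    neighbours so chosen different for different paths. *)
Lemma card_paths_through (P : {set {set G}}) (w : {set G} -> seq G) (v : G) :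
  pairing P -> (forall B, B \in P -> path_joining B (w B)) ->
  (forall B C, B \in P -> C \in P -> B != C ->
     [disjoint path_edges (w B) & path_edges (w C)]) ->
  #|[set B in P | v \in w B]| <= degree v.
Proof.
move=> /andP[_ /forallP cardP] wP w_disj.
have edge_at B : B \in P -> v \in w B ->
    exists u, adj v u /\ [set v; u] \in path_edges (w B).
  move=> BP; have := wP B BP; have := cardP B; rewrite BP /= /path_edges.
  case: (w B) => // x p /eqP B2 /and3P[pth _ /eqP BE]; rewrite BE in B2.
  have {B2 BE} : p != [::] by apply: contraPneq B2 => ->; rewrite setUid cards1.
  elim: p x pth => // y p IHp x /= /andP[xy pth] _.
  have here : [set x; y] \in [set [set u.1; u.2] | u in zip [:: x, y & p] (y :: p)].
    by apply/imsetP; exists (x, y) => //=; rewrite inE eqxx.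
  rewrite inE => /orP[/eqP->|]; first by exists y.
  have [p0|p0] := eqVneq p [::].
    by rewrite {1}p0 inE => /eqP->; exists x; rewrite (@adj_sym G) (setUC [set y]).
  move=> /(IHp y pth p0)[u [vu /imsetP[e ep eE]]]; exists u; split=> //.
  by apply/imsetP; exists e => //; rewrite inE ep orbT.
have /fin_all_exists[u uP] (B : {set G}) : exists u, B \in P -> v \in w B ->
    adj v u /\ [set v; u] \in path_edges (w B).
  case: (boolP ((B \in P) && (v \in w B))) => [/andP[BP vB]|nB].
    by have [u uB] := edge_at B BP vB; exists u.
  by exists v => BP vB; rewrite BP vB in nB.
rewrite -(@card_in_imset _ _ u) /degree; last first.
  move=> B C; rewrite !inE => /andP[BP vB] /andP[CP vC] uBC.
  apply/eqP; apply: contraT => /(w_disj B C BP CP); rewrite -setI_eq0.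
  move=> /eqP/setP/(_ [set v; u B]); rewrite !inE.
  by rewrite (uP B BP vB).2 uBC (uP C CP vC).2.
apply/subset_leq_card/subsetP => _ /imsetP[B + ->].
by rewrite !inE => /andP[BP vB]; have [] := uP B BP vB.
Qed.

End Routing.

Definition pairs_through (G : sgraph) (Q : G -> G -> seq G) (v : G) :
  {set G * G} := [set xy | (xy.1 != xy.2) && (v \in Q xy.1 xy.2)].

(** [path_joining] leaves the direction open, so a path that starts at [y] is reversed. *)
Lemma path_joining_walk (G : sgraph) (x y : G) (s : seq G) : x != y ->
  path_joining [set x; y] s ->
  exists p, [/\ path (@adj G) x p, last x p = y & {subset x :: p <= s}].
Proof.
move=> xy; case: s => // a p /and3P[pth _ /eqP/setP ends].
have adjC : (fun u v => adj v u) =2 @adj G by move=> u v; rewrite adj_sym.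
have := ends x; have := ends y; rewrite !inE !eqxx !orbT.
case/esym/orP => /eqP yE /esym/orP[]/eqP xE.
- by rewrite xE yE eqxx in xy.
- exists (rev (belast a p)); rewrite xE yE -(eq_path adjC) rev_path pth.
  split=> //; first by case: (p) => //= b q; rewrite rev_cons last_rcons.
  by move=> z; rewrite -rev_rcons -lastI mem_rev.
- by exists p; rewrite xE yE; split.
- by rewrite xE yE eqxx in xy.
Qed.

(** Two vertices are routed within a pairing that matches them. In each of the [#|G|] pairings at
    most [degree v] paths pass through [v], and each serves two ordered pairs. *)
Lemma pair_routes (G : sgraph) : path_pairable G -> 0 < #|G| ->
  exists Q : G -> G -> seq G,
    (forall x y, x != y -> exists p,
       [/\ path (@adj G) x p, last x p = y & {subset x :: p <= Q x y}]) /\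
    forall v, #|pairs_through Q v| <= #|G| * (2 * degree v).
Proof.
case; rewrite cardsT => even_G pairable G0.
have [tau [tauK tau_neq tau_cover]] := round_robin G0 even_G.
pose T k x : G := enum_val (tau k (enum_rank x)).
have TK k : involutive (T k).
  by move=> x; rewrite /T enum_valK tauK enum_rankK.
have T_neq k x : T k x != x.
  by rewrite -{2}(enum_rankK x) (inj_eq enum_val_inj) tau_neq.
have T_cover x y : x != y -> exists k, T k x = y.
  rewrite -(inj_eq enum_rank_inj) => /tau_cover[k kxy]; exists k.
  by rewrite /T kxy enum_rankK.
pose P k := [set [set x; T k x] | x in [set: G]].
have PP k : pairing (P k) by apply: pairing_involution.
have /fin_all_exists[w w_P] k := pairable _ (PP k).
have /fin_all_exists[kk kkP] (xy : G * G) : exists k, xy.1 != xy.2 -> T k xy.1 = xy.2.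
  have [e|/T_cover[k]] := eqVneq xy.1 xy.2; last by exists k.
  by exists (enum_rank xy.1).
exists (fun x y => w (kk (x, y)) [set x; y]); split=> [x y xy|v].
  apply: path_joining_walk => //; have [wj _] := w_P (kk (x, y)); apply: wj.
  by apply/imsetP; exists x; rewrite ?(kkP (x, y) xy).
pose D k := [set B in P k | v \in w k B].
pose S k := [set x | v \in w k [set x; T k x]].
have cardS k : #|S k| <= 2 * degree v.
  have Sk : S k \subset cover (D k).
    apply/subsetP => x; rewrite inE => vx; apply/bigcupP; exists [set x; T k x].
      by rewrite inE vx andbT; apply: imset_f.
    exact: set21.
  apply: leq_trans (subset_leq_card Sk) _; apply: leq_trans (leq_card_cover _) _.
  have [wj w_disj] := w_P k.
  have := card_paths_through v (PP k) wj w_disj.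
  rewrite -(leq_pmul2l (isT : 0 < 2)); apply: leq_trans.
  rewrite mulnC -sum_nat_const; apply: leq_sum => B; rewrite inE => /andP[BP _].
  by have /andP[_ /forallP/(_ B)] := PP k; rewrite BP => /eqP->.
pose E := [set kx : 'I_#|G| * G | kx.2 \in S kx.1].
(* An ordered pair is recovered from its first vertex and the index of its pairing. *)
have sub : pairs_through (fun x y => w (kk (x, y)) [set x; y]) v \subset
    [set (kx.2, T kx.1 kx.2) | kx in E].
  apply/subsetP => -[x y]; rewrite in_set /= => /andP[xy vQ].
  have Txy := kkP (x, y) xy.
  by apply/imsetP; exists (kk (x, y), x); rewrite ?in_set /= Txy.
apply: leq_trans (subset_leq_card sub) _; apply: leq_trans (leq_imset_card _ _) _.
have -> : #|E| = \sum_k #|S k|.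
  under [RHS]eq_bigr do rewrite -sum1_card.
  by rewrite pair_big_dep -sum1_card; apply: eq_bigl => kx; rewrite in_set.
rewrite -[in leqRHS](card_ord #|G|) -sum_nat_const.
by apply: leq_sum => k _; exact: cardS.
Qed.

(** * Counting meetings of routes and the degree bound *)

(** Such an [f] is determined by its values on the two pairs and at the one remaining index. *)
Lemma card_ffun_two_pairs (T : finType) (A : {set T * T}) (i j k l : 'I_5) :
  uniq [:: i; j; k; l] ->
  #|[set f : {ffun 'I_5 -> T} | ((f i, f j) \in A) && ((f k, f l) \in A)]|
    <= #|A| * #|A| * #|T|.
Proof.
move=> ijkl; have [m mijkl] : exists m, m \notin [:: i; j; k; l].
  apply/existsP; apply: contraT; rewrite negb_exists => /forallP all_in.
  have sub : {subset enum 'I_5 <= [:: i; j; k; l]} by move=> q _; exact/negPn/all_in.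
  by have := uniq_leq_size (enum_uniq 'I_5) sub; rewrite -cardE card_ord.
have cover5 q : q \in [:: m; i; j; k; l].
  apply: contraT => nq.
  have u6 : uniq [:: q, m, i, j, k & [:: l]] by rewrite cons_uniq nq cons_uniq mijkl.
  by have := max_card [in [:: q, m, i, j, k & [:: l]]]; rewrite (card_uniqP u6) card_ord.
rewrite -!cardsT -!cardsX.
pose h (f : {ffun 'I_5 -> T}) := ((f i, f j), (f k, f l), f m).
rewrite -(@card_in_imset _ _ h).
  apply/subset_leq_card/subsetP => _ /imsetP[f + ->].
  by rewrite !inE => /andP[-> ->].
move=> f g _ _ [fi fj fk fl fm]; apply/ffunP => q.
by move: (cover5 q); rewrite !inE => /or4P[|||/orP[]]/eqP->.
Qed.

(** Double counting of the injective maps from ['I_5] to [G]: each has two disjoint pairs of indices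
    whose routes meet at some [v]. The factor 5 ^ 4 counts the quadruples of indices. *)
Lemma sum_crossing_pairs (R : realType) (G : sgraph) (Q : G -> G -> seq G) :
  planar R G -> (forall x y, x != y -> exists p,
    [/\ path (@adj G) x p, last x p = y & {subset x :: p <= Q x y}]) ->
  #|G| ^_ 5 <= \sum_(v : G) 5 ^ 4 * (#|pairs_through Q v| ^ 2 * #|G|).
Proof.
move=> plG QP.
have /fin_all_exists[p pP] (xy : G * G) : exists p, xy.1 != xy.2 ->
    [/\ path (@adj G) xy.1 p, last xy.1 p = xy.2 & {subset xy.1 :: p <= Q xy.1 xy.2}].
  have [_|/QP[p pP]] := eqVneq xy.1 xy.2; first by exists [::].
  by exists p.
pose I := ('I_5 * 'I_5 * ('I_5 * 'I_5))%type.
pose S v (q : I) := [set f : {ffun 'I_5 -> G} |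
  [&& uniq [:: q.1.1; q.1.2; q.2.1; q.2.2],
   (f q.1.1, f q.1.2) \in pairs_through Q v & (f q.2.1, f q.2.2) \in pairs_through Q v]].
have cardS v q : #|S v q| <= #|pairs_through Q v| ^ 2 * #|G|.
  have [ijkl|nu] := boolP (uniq [:: q.1.1; q.1.2; q.2.1; q.2.2]).
    rewrite -mulnn; apply: leq_trans (card_ffun_two_pairs _ ijkl).
    by apply/subset_leq_card/subsetP => f; rewrite !in_set => /andP[].
  by rewrite (eqP (_ : #|S v q| == 0)) // cards_eq0; apply/eqP/setP => f;
    rewrite in_set (negPf nu) in_set0.
have meet (f : {ffun 'I_5 -> G}) : injective f -> exists v q, f \in S v q.
  move=> f_inj; have f_neq (i j : 'I_5) : i < j -> f i != f j.
    by rewrite (inj_eq f_inj) ltn_neqAle => /andP[].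
  have [||i [j [k [l [ij kl ijkl [v]]]]]] :=
    @planar_walks_meet R G f (fun i j => p (f i, f j)) plG f_inj.
  - by move=> i j /f_neq ij; have [] := pP (f i, f j) ij.
  - by move=> i j /f_neq ij; have [] := pP (f i, f j) ij.
  have [_ _ sub1] := pP (f i, f j) (f_neq _ _ ij).
  have [_ _ sub2] := pP (f k, f l) (f_neq _ _ kl).
  move=> /sub1 v1 /sub2 v2; exists v, ((i, j), (k, l)).
  by rewrite in_set ijkl !in_set /= !f_neq //= v1 v2.
have := card_inj_ffuns 'I_5 G; rewrite card_ord => <-.
have -> : 5 ^ 4 = #|{: I}| by rewrite !card_prod !card_ord.
under eq_bigr do rewrite -sum_nat_const.
apply: (@leq_trans (\sum_(v : G) \sum_(q : I) #|S v q|)); last first.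
  by apply: leq_sum => v _; apply: leq_sum => q _; exact: cardS.
under eq_bigr do under eq_bigr do rewrite -sum1_card big_mkcond.
under eq_bigr do rewrite exchange_big.
rewrite exchange_big -sum1_card big_mkcond; apply: leq_sum => f _.
rewrite inE; case: injectiveP => // /meet[v [q fS]].
by rewrite (bigD1 v)//= (bigD1 q)//= fS.
Qed.

(** For n >= 8 each of the factors n, ..., n - 4 is at least n / 2. *)
Lemma expn_ffact5 n : 8 <= n -> n ^ 5 <= 2 ^ 5 * n ^_ 5.
Proof.
move=> n8; rewrite !ffactnS ffactn0 muln1 !expnS !expn0 !muln1.
suff : n * (n * (n * (n * n))) <=
    (2 * n) * ((2 * n.-1) * ((2 * n.-2) * ((2 * n.-2.-1) * (2 * n.-2.-2)))).
  by move/leq_trans; apply; rewrite -!mulnA; nia.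
by rewrite !leq_mul//; lia.
Qed.

(** An even positive order gives two distinct vertices, and the route between them has a first edge.
    This settles the graphs with fewer than eight vertices. *)
Lemma path_pairable_max_degree_gt0 (G : sgraph) : path_pairable G -> 0 < #|G| ->
  0 < max_degree G.
Proof.
move=> pG G0; have [Q [QP _]] := pair_routes pG G0.
have [even_G _] := pG; rewrite cardsT in even_G.
have : 1 < #|G| by case: #|G| even_G G0 => [|[]].
case/card_gt1P => x [y [_ _ xy]]; have [p [pth lst _]] := QP x y xy.
case: p pth lst => [_ /= e|z p /= /andP[xz _] _]; first by rewrite e eqxx in xy.
apply: (@leq_trans (degree x)); last exact: leq_bigmax.
by apply/card_gt0P; exists z; rewrite in_set.
Qed.

Lemma planar_path_pairable_degree (R : realType) (G : sgraph) : path_pairable G ->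
  planar R G -> #|G| <= 2 ^ 21 * max_degree G.
Proof.
move=> pG plG; have [->//|G0] := posnP #|G|.
have [n8|n8] := ltnP #|G| 8.
  apply: (leq_trans (ltnW n8)).
  rewrite -[8]/(2 ^ 3) -[leqLHS]muln1 leq_mul ?leq_pexp2l//.
  exact: path_pairable_max_degree_gt0.
have [Q [QP Q_le]] := pair_routes pG G0.
(* One of the two factors is bounded through the maximum degree, the other through [degree v], so
   that a plain degree sum remains. *)
have bound v : 5 ^ 4 * (#|pairs_through Q v| ^ 2 * #|G|)
    <= 5 ^ 4 * 2 ^ 2 * (#|G| ^ 3 * max_degree G) * degree v.
  have dv : degree v <= max_degree G by exact: leq_bigmax.
  have tD : #|pairs_through Q v| <= #|G| * (2 * max_degree G).
    by apply: leq_trans (Q_le v) _; rewrite !leq_mul2l dv !orbT.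
  have -> : 5 ^ 4 * 2 ^ 2 * (#|G| ^ 3 * max_degree G) * degree v = 5 ^ 4 *
      (#|G| * (2 * max_degree G) * (#|G| * (2 * degree v)) * #|G|) by ring.
  by rewrite leq_mul2l -mulnn leq_mul2r leq_mul ?orbT.
have := sum_crossing_pairs plG QP.
move/leq_trans => /(_ _ (leq_sum _ (fun v _ => bound v))); rewrite -big_distrr /=.
move=> ffact_le; have := expn_ffact5 n8.
have {}ffact_le : #|G| ^_ 5 <= 2 ^ 16 * (#|G| ^ 4 * max_degree G).
  apply: (leq_trans ffact_le).
  apply: (@leq_trans (5 ^ 4 * 2 ^ 2 * (#|G| ^ 3 * max_degree G) * (2 ^ 4 * #|G|))).
    by rewrite leq_mul2l (ltnW (planar_degree_sum plG G0)) orbT.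
  rewrite [#|G| ^ 4]expnSr.
  (* This reduces to 5 ^ 4 <= 2 ^ 10. Together with the 2 ^ 5 of [expn_ffact5] it yields the
     constant 2 ^ 21. *)
  have c : 5 ^ 4 * 2 ^ 2 * 2 ^ 4 <= 2 ^ 16.
    by rewrite -mulnA -expnD (_ : 16 = 10 + 6)// (expnD 2 10) leq_mul2r.
  move: (#|G| ^ 3) (max_degree G) c => a b.
  have -> : 5 ^ 4 * 2 ^ 2 * (a * b) * (2 ^ 4 * #|G|)
    = (5 ^ 4 * 2 ^ 2 * 2 ^ 4) * (a * #|G| * b) by ring.
  by move=> c; rewrite leq_mul2r c orbT.
move/leq_trans => /(_ _ (leq_mul (leqnn _) ffact_le)).
rewrite mulnA -expnD expnSr [leqRHS]mulnCA leq_pmul2l// expn_gt0 G0 //.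
Qed.

Local Open Scope ring_scope.

Theorem theorem2 (R : realType) :
  exists c : R, 10 ^- (10 ^ 10)%N <= c /\
    forall G : sgraph, path_pairable G -> planar R G ->
      c * #|[set: G]%SET|%:R <= (max_degree G)%:R.
Proof.
(* 2 ^ 21 <= 10 ^ 21 <= 10 ^ m for every m >= 21; the huge exponent is generalised to such an m and
   never computed. *)
exists (2 ^- 21); split.
  have : (21 <= 10 ^ 10)%N.
    by apply: (@leq_trans (10 ^ 2)); [|rewrite leq_pexp2l].
  move: (10 ^ 10)%N => m m21.
  rewrite lef_pV2 ?posrE ?exprn_gt0//.
  apply: (@le_trans _ _ (10 ^+ 21)); last by rewrite ler_weXn2l// ler1n.
  by rewrite lerXn2r ?nnegrE ?ler_nat.
move=> G pG plG; rewrite cardsT mulrC ler_pdivrMr ?exprn_gt0//.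
by rewrite -natrX -natrM ler_nat mulnC (planar_path_pairable_degree pG plG).
Qed.
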